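(* Let $Y,U\in\mathbb{R}_+^{(N+1)\times m}$. Assume that for all $i\in\{0,\dots,N\}$ there exists $j\in\{1,\dots,m\}$ such that $Y_{ij}>0$ and $U_{0j}>0$. Then the problem of minimizing $F(h)=\mathcal{I}(Y\|T(h)U)$ over $h\in\mathbb{R}_+^{N+1}$ admits a unique solution.
   Context: $N\ge 0$ and $m\ge 1$ are integers. Rows of $Y,U$ are indexed by $0,\dots,N$, columns by $1,\dots,m$. For $h=(h_0,\dots,h_N)^\top\in\mathbb{R}_+^{N+1}$ (nonnegative entries), $T(h)$ is the $(N+1)\times(N+1)$ lower triangular Toeplitz matrix with entries $T(h)_{ik}=h_{i-k}$ for $i\ge k$ and $0$ otherwise, so $(T(h)U)_{ij}=\sum_{k=0}^i h_kU_{i-k,j}$. For nonnegative matrices $A,B$ of the same size, the I-divergence is $\mathcal{I}(A\|B)=\sum_{ij}\big(A_{ij}\log\frac{A_{ij}}{B_{ij}}-A_{ij}+B_{ij}\big)$ if $A_{ij}=0$ whenever $B_{ij}=0$, and $\mathcal{I}(A\|B)=+\infty$ otherwise, with the conventions $\frac00=0$, $0\log 0=0$.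
   Formalization: The formal theorem also assumes that F(h) is finite for some h in the nonnegative orthant; without this the claim fails, e.g. N=0, m=2, Y=(1 1), U=(1 0), where F is +∞ for every h and so has no unique minimizer. *)

(* Defs.v *)
From HB Require Import structures.
From mathcomp Require Import all_boot all_order all_algebra.
From mathcomp Require Import all_classical all_reals all_analysis.

Set Implicit Arguments.
Unset Strict Implicit.
Unset Printing Implicit Defensive.

Import Order.TTheory GRing.Theory Num.Theory.
Local Open Scope ring_scope.

Definition toeplitz (R : realType) (N : nat) (h : 'cV[R]_N.+1) : 'M[R]_N.+1 :=
  \matrix_(i, k) if (k <= i)%N then h (inord (i - k)) 0 else 0.

(* Since [x / 0 = 0], the term of a pair (0, 0) is 0 and that of (0, b) is b,
   which agrees with the conventions 0/0 = 0 and 0 log 0 = 0. *)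
Definition Idiv (R : realType) (p q : nat) (A B : 'M[R]_(p, q)) : \bar R :=
  if [forall i, forall j, (B i j == 0) ==> (A i j == 0)] then
    (\sum_i \sum_j (A i j * ln (A i j / B i j) - A i j + B i j))%:E
  else +oo%E.

Definition objective (R : realType) (N m : nat) (Y U : 'M[R]_(N.+1, m))
    (h : 'cV[R]_N.+1) : \bar R :=
  Idiv Y (toeplitz h *m U).

Definition is_minimizer (R : realType) (T : Type) (D : set T) (F : T -> \bar R)
    (x : T) : Prop :=
  D x /\ forall y, D y -> (F x <= F y)%E.

(* The closed orthant; [h \is a mxOver Num.nneg] means that all entries of [h]
   are >= 0. *)
Definition orthant (R : realType) (n : nat) : set 'cV[R]_n :=
  [set h | h \is a mxOver Num.nneg]%classic.

(* Main.v *)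
Require Import Defs.
From HB Require Import structures.
From mathcomp Require Import all_boot all_order all_algebra.
From mathcomp Require Import all_classical all_reals all_analysis.
From mathcomp Require Import ring lra.

Set Implicit Arguments.
Unset Strict Implicit.
Unset Printing Implicit Defensive.

Import Order.TTheory GRing.Theory Num.Theory.
Import numFieldNormedType.Exports.
Local Open Scope ring_scope.

(** Existence: every term d(a, b) = a log (a/b) - a + b of the divergence is
    nonnegative and satisfies b <= 2 (d(a, b) + a).  As (T(h)U)_ij >= h_i U_0j,
    the sublevel set of a feasible h0 is therefore bounded.  On it the entries of
    T(h)U facing a positive Y_ij also stay above Y_ij exp (-1 - F(h0)/Y_ij), away
    from the singularity of the logarithm, so F attains its minimum there by
    compactness.  Uniqueness: d(a, .) is strictly convex for a > 0, and at the
    first index i where h and g differ, choosing j with Y_ij > 0 and U_0j > 0,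
    (T(h)U)_ij - (T(g)U)_ij = (h_i - g_i) U_0j is nonzero; hence the midpoint of
    two distinct minimizers would be strictly better. *)

(** * One term of the divergence: bounds, convexity, continuity *)

Definition idterm (R : realType) (a b : R) : R := a * ln (a / b) - a + b.

Lemma idterm0 (R : realType) (b : R) : idterm 0 b = b.
Proof. by rewrite /idterm mul0r subr0 add0r. Qed.

(** Inverting the ratio lets ln x <= x - 1 at x = b / a bound the term from below. *)
Lemma idtermE (R : realType) (a b : R) : 0 < a -> 0 < b ->
  idterm a b = b - a - a * ln (b / a).
Proof.
move=> a0 b0; rewrite /idterm !ln_div ?posrE//; ring.
Qed.

Lemma ln_le_subr1 (R : realType) (x : R) : 0 < x -> ln x <= x - 1.
Proof.
by move=> x0; rewrite -{1}(subrKC 1 x) le_ln1Dx// ltrBrDr addrC subrr.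
Qed.

Lemma pos_of_support (R : realType) (a b : R) :
  0 < a -> 0 <= b -> (b = 0 -> a = 0) -> 0 < b.
Proof.
rewrite le0r => a0 /orP[/eqP b0 /(_ b0) a00|//].
by rewrite a00 ltxx in a0.
Qed.

Lemma idterm_ge0 (R : realType) (a b : R) : 0 <= a -> 0 <= b ->
  (b = 0 -> a = 0) -> 0 <= idterm a b.
Proof.
rewrite le_eqVlt => /orP[/eqP <- b0 _|a0 b0 ba]; first by rewrite idterm0.
have {}b0 := pos_of_support a0 b0 ba.
rewrite idtermE//.
have : a * ln (b / a) <= a * (b / a - 1).
  by rewrite ler_wpM2l// ?ln_le_subr1 ?divr_gt0// ltW.
rewrite mulrBr mulrCA divff ?gt_eqF// !mulr1; lra.
Qed.

(** Using ln x <= x - 1 at b / (2 a) instead of b / a costs a ln 2 <= a but keeps b / 2 of the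
    linear term. *)
Lemma idterm_coercive (R : realType) (a b : R) : 0 <= a -> 0 <= b ->
  (b = 0 -> a = 0) -> b <= 2 * (idterm a b + a).
Proof.
rewrite le_eqVlt => /orP[/eqP <- b0 _|a0 b0 ba]; first by rewrite idterm0; lra.
have {}b0 := pos_of_support a0 b0 ba.
have e : b / a = 2 * (b / (2 * a)) by field; rewrite gt_eqF.
have c0 : 0 < b / (2 * a) by rewrite divr_gt0// mulr_gt0.
rewrite idtermE// e lnM ?posrE//.
have l1 := ln_le_subr1 c0.
have l2 : ln (2 : R) <= 2 - 1 by apply: ln_le_subr1.
have : a * (ln 2 + ln (b / (2 * a))) <= a * (b / (2 * a)).
  by apply: ler_wpM2l; [exact: ltW|lra].
have -> : a * (b / (2 * a)) = b / 2 by field; rewrite gt_eqF.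
lra.
Qed.

(** Dropping b > 0 from b - a - a ln (b / a) <= d leaves ln (b / a) >= - (1 + d / a). *)
Lemma idterm_le_lower (R : realType) (a b d : R) : 0 < a -> 0 < b ->
  idterm a b <= d -> a * expR (- (1 + d / a)) <= b.
Proof.
move=> a0 b0; rewrite idtermE// => le_d.
rewrite mulrC -ler_pdivlMr// -[leRHS]lnK ?posrE ?divr_gt0// ler_expR.
rewrite -(ler_pM2l a0) mulrN mulrDr mulrCA divff ?gt_eqF//; lra.
Qed.

(** Strict AM-GM: 4 x y < (x + y)^2 because (x - y)^2 > 0. *)
Lemma ln_midpoint (R : realType) (x y : R) : 0 < x -> 0 < y -> x != y ->
  ln x + ln y < 2 * ln ((x + y) / 2).
Proof.
move=> x0 y0 xy.
have m0 : 0 < (x + y) / 2 by rewrite divr_gt0// addr_gt0.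
rewrite mulr_natl mulr2n -!lnM ?posrE// ltr_ln ?posrE ?mulr_gt0 ?addr_gt0//.
have : 0 < (x - y) ^+ 2 by rewrite exprn_even_gt0//= subr_eq0.
rewrite expr2; lra.
Qed.

Lemma idterm_midpoint_lt (R : realType) (a x y : R) :
  0 < a -> 0 < x -> 0 < y -> x != y ->
  2 * idterm a ((x + y) / 2) < idterm a x + idterm a y.
Proof.
move=> a0 x0 y0 xy.
have m0 : 0 < (x + y) / 2 by rewrite divr_gt0// addr_gt0.
rewrite !idtermE// (ln_div (x := x)) ?(ln_div (x := y))
  ?(ln_div (x := (x + y) / 2)) ?posrE//.
have := ln_midpoint x0 y0 xy; rewrite -(ltr_pM2l a0); lra.
Qed.

Lemma idterm_midpoint_le (R : realType) (a x y : R) :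
  0 <= a -> 0 <= x -> 0 <= y -> (x = 0 -> a = 0) -> (y = 0 -> a = 0) ->
  2 * idterm a ((x + y) / 2) <= idterm a x + idterm a y.
Proof.
rewrite le_eqVlt => /orP[/eqP <- *|a0 x0 y0 xa ya]; first by rewrite !idterm0; lra.
have [->|xy] := eqVneq x y.
  have -> : (y + y) / 2 = y by field.
  lra.
by apply/ltW/idterm_midpoint_lt => //; exact: (pos_of_support a0).
Qed.

(** For a = 0 the term is the identity in b, so b = 0 is harmless; only a > 0 requires avoiding the
    singularity of ln. *)
Lemma continuous_idterm (R : realType) (a b : R) : 0 <= a ->
  (0 < a -> 0 < b) -> {for b, continuous (idterm a)}.
Proof.
rewrite le_eqVlt => /orP[/eqP <- _|a0 /(_ a0) b0].
  rewrite (_ : idterm 0 = id)//; by apply/funext => x; rewrite idterm0.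
apply: cvgD; last by [].
apply: cvgB; last exact: cvg_cst.
apply: cvgM; first exact: cvg_cst.
apply: (@cvg_comp _ _ _ (fun x => a / x) (@ln R)); last first.
  by apply: continuous_ln; rewrite divr_gt0.
by apply: cvgM; [exact: cvg_cst|apply: cvgV; [rewrite gt_eqF|]].
Qed.

(** * Matrix divergence where it is finite *)

Definition support_le (R : realType) (p q : nat) (A B : 'M[R]_(p, q)) : Prop :=
  forall i j, B i j = 0 -> A i j = 0.

(** Real-valued, to allow real analysis; off [support_le] the convention x / 0 = 0 yields a finite
    value in place of +oo. *)
Definition Idivr (R : realType) (p q : nat) (A B : 'M[R]_(p, q)) : R :=
  \sum_i \sum_j idterm (A i j) (B i j).

Lemma Idiv_fin (R : realType) (p q : nat) (A B : 'M[R]_(p, q)) :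
  support_le A B -> Idiv A B = (Idivr A B)%:E.
Proof.
move=> AB; rewrite /Idiv ifT//; apply/forallP => i; apply/forallP => j.
by apply/implyP => /eqP/AB ->.
Qed.

Lemma Idiv_lty (R : realType) (p q : nat) (A B : 'M[R]_(p, q)) :
  (Idiv A B < +oo)%E -> support_le A B.
Proof.
rewrite /Idiv; case: ifPn => [|_]; last by rewrite ltxx.
move=> AB _ i j /eqP Bij; apply/eqP.
by move/forallP: AB => /(_ i)/forallP/(_ j)/implyP; exact.
Qed.

Lemma idterm_le_Idivr (R : realType) (p q : nat) (A B : 'M[R]_(p, q)) i j :
  A \is a mxOver Num.nneg -> B \is a mxOver Num.nneg -> support_le A B ->
  idterm (A i j) (B i j) <= Idivr A B.
Proof.
move=> /mxOverP A0 /mxOverP B0 AB.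
have t0 k l : 0 <= idterm (A k l) (B k l).
  by apply: idterm_ge0; [exact: A0|exact: B0|exact: AB].
rewrite /Idivr (bigD1 i)//= (bigD1 j)//= -addrA lerDl addr_ge0//.
  by apply: sumr_ge0.
by apply: sumr_ge0 => k _; apply: sumr_ge0.
Qed.

(** One strict entry is enough, as all others satisfy the weak midpoint inequality. *)
Lemma Idivr_midpoint_lt (R : realType) (p q : nat) (A B C : 'M[R]_(p, q)) i j :
  A \is a mxOver Num.nneg -> B \is a mxOver Num.nneg ->
  C \is a mxOver Num.nneg -> support_le A B -> support_le A C ->
  0 < A i j -> B i j != C i j ->
  2 * Idivr A (2^-1 *: (B + C)) < Idivr A B + Idivr A C.
Proof.
move=> /mxOverP A0 /mxOverP B0 /mxOverP C0 AB AC Aij BC.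
have le k l : 2 * idterm (A k l) ((2^-1 *: (B + C)) k l) <=
              idterm (A k l) (B k l) + idterm (A k l) (C k l).
  rewrite !mxE [2^-1 * _]mulrC; apply: idterm_midpoint_le;
    [exact: A0|exact: B0|exact: C0|exact: AB|exact: AC].
rewrite /Idivr mulr_sumr -big_split/=.
rewrite (bigD1 i)//= [ltRHS](bigD1 i)//=; apply: ltr_leD; last first.
  by apply: ler_sum => k _; rewrite mulr_sumr -big_split/=; apply: ler_sum.
rewrite mulr_sumr -big_split/= (bigD1 j)//= [ltRHS](bigD1 j)//=.
apply: ltr_leD; last by apply: ler_sum.
rewrite !mxE [2^-1 * _]mulrC; apply: idterm_midpoint_lt => //.
  exact: (pos_of_support Aij (B0 i j) (@AB i j)).
exact: (pos_of_support Aij (C0 i j) (@AC i j)).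
Qed.

(** * Toeplitz products *)

Lemma toeplitz_midpoint (R : realType) (N : nat) (h g : 'cV[R]_N.+1) :
  toeplitz (2^-1 *: (h + g)) = 2^-1 *: (toeplitz h + toeplitz g).
Proof.
by apply/matrixP => i k; rewrite !mxE; case: ifP; rewrite ?addr0 ?mulr0.
Qed.

Lemma toeplitz_mul_ge0 (R : realType) (N m : nat) (h : 'cV[R]_N.+1)
    (U : 'M[R]_(N.+1, m)) : h \is a mxOver Num.nneg ->
  U \is a mxOver Num.nneg -> toeplitz h *m U \is a mxOver Num.nneg.
Proof.
move=> /mxOverP h0 U0; apply: mxOverM => //; apply/mxOverP => i k.
by rewrite mxE; case: ifP => _; [exact: h0|exact: rpred0].
Qed.

(** The left side is the k = 0 summand of the right; the others are nonnegative. *)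
Lemma toeplitz_mul_ge (R : realType) (N m : nat) (h : 'cV[R]_N.+1)
    (U : 'M[R]_(N.+1, m)) i j : h \is a mxOver Num.nneg ->
  U \is a mxOver Num.nneg -> h i 0 * U ord0 j <= (toeplitz h *m U) i j.
Proof.
move=> /mxOverP h0 /mxOverP U0; rewrite mxE (bigD1 ord0)//= !mxE subn0 inord_val.
rewrite lerDl; apply: sumr_ge0 => k _; rewrite mxE.
apply: mulr_ge0; last exact: U0.
by case: ifP => // _; exact: h0.
Qed.

(** Summands with 0 < k <= i involve entries of index i - k < i, where h and g agree, and cancel. *)
Lemma toeplitz_mul_sub (R : realType) (N m : nat) (h g : 'cV[R]_N.+1)
    (U : 'M[R]_(N.+1, m)) (i : 'I_N.+1) j :
  (forall k : 'I_N.+1, (k < i)%N -> h k 0 = g k 0) ->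
  (toeplitz h *m U) i j - (toeplitz g *m U) i j = (h i 0 - g i 0) * U ord0 j.
Proof.
move=> hg; rewrite !mxE -sumrB (bigD1 ord0)//= big1 ?addr0 => [|k k0].
  by rewrite !mxE subn0 inord_val -mulrBl.
rewrite !mxE; case: ifP => [ki|_]; last by rewrite subrr.
rewrite hg ?subrr// inordK; last by rewrite ltnS (leq_trans (leq_subr _ _))// -ltnS.
have k1 : (0 < k)%N by rewrite lt0n.
by rewrite ltn_subrL k1 (leq_trans k1 ki).
Qed.

(** * Continuity and existence of a minimizer *)

Lemma continuous_at_sum (T : topologicalType) (R : realType) (I : finType)
    (f : I -> T -> R) (x : T) : (forall i, {for x, continuous (f i)}) ->
  {for x, continuous (fun y => \sum_i f i y)}.
Proof.
move=> fc; apply: (@cvg_big R I +%R) => [|i _]; last exact: fc.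
exact: add_continuous.
Qed.

(** The argument is a transposed row because the compactness and extreme value theorems used below
    concern rows. *)
Lemma continuous_toeplitz_mul (R : realType) (N m : nat) (U : 'M[R]_(N.+1, m)) i j :
  continuous (fun v : 'rV[R]_N.+1 => (toeplitz v^T *m U) i j).
Proof.
rewrite (_ : (fun _ => _) =
    fun v : 'rV_N.+1 => \sum_(k < N.+1) (if (k <= i)%N then v 0 (inord (i - k)) else 0)
      * U k j).
  move=> v; apply: continuous_at_sum => k; apply: (@continuousM R 'rV[R]_N.+1
    (fun v => if (k <= i)%N then v 0 (inord (i - k)) else 0) (fun=> U k j)).
    by case: (k <= i)%N; [exact: coord_continuous|exact: cst_continuous].
  exact: cst_continuous.
apply/funext => v; rewrite mxE; apply: eq_bigr => k _; rewrite !mxE.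
by case: ifP; rewrite ?mxE.
Qed.

Lemma Idivr_toeplitz_has_min (R : realType) (N m : nat)
    (Y U : 'M[R]_(N.+1, m)) (h0 : 'cV[R]_N.+1) :
  Y \is a mxOver Num.nneg -> U \is a mxOver Num.nneg ->
  (forall i : 'I_N.+1, exists j : 'I_m, 0 < U ord0 j) ->
  h0 \is a mxOver Num.nneg -> support_le Y (toeplitz h0 *m U) ->
  exists h : 'cV[R]_N.+1, [/\ h \is a mxOver Num.nneg,
    support_le Y (toeplitz h *m U) &
    forall g : 'cV[R]_N.+1, g \is a mxOver Num.nneg ->
      support_le Y (toeplitz g *m U) ->
      Idivr Y (toeplitz h *m U) <= Idivr Y (toeplitz g *m U)].
Proof.
move=> Y0 U0 /choice[j jU] h0_ge0 h0_supp.
have /mxOverP Y_ge0 := Y0.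
set F := fun h : 'cV[R]_N.+1 => Idivr Y (toeplitz h *m U).
(* From h_i U_0j <= (T(h)U)_ij and [idterm_coercive], each term being at most F h0 on the sublevel
   set. *)
pose C i := 2 * (F h0 + Y i (j i)) / U ord0 (j i).
(* The bound of [idterm_le_lower] at d = F h0, used only where Y_il > 0. *)
pose e i l := Y i l * expR (- (1 + F h0 / Y i l)).
pose box := [set v : 'rV[R]_N.+1 | forall i, `[0, C i]%classic (v ord0 i)]%classic.
pose pos := (\bigcap_(il in [set il | 0 < Y il.1 il.2])
  [set v : 'rV[R]_N.+1 | e il.1 il.2 <= (toeplitz v^T *m U) il.1 il.2])%classic.
pose K := (box `&` pos)%classic.
have sublevelK g : g \is a mxOver Num.nneg -> support_le Y (toeplitz g *m U) ->
    F g <= F h0 -> K g^T.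
  move=> g0 gs Fg.
  have /mxOverP Tg0 := toeplitz_mul_ge0 g0 U0.
  have tF i l : idterm (Y i l) ((toeplitz g *m U) i l) <= F h0.
    exact: le_trans (idterm_le_Idivr i l Y0 (toeplitz_mul_ge0 g0 U0) gs) Fg.
  split=> [i|[i l] /= Yil].
    rewrite /= in_itv/= mxE; apply/andP; split; first exact: (mxOverP g0).
    rewrite /C ler_pdivlMr//; apply: le_trans (toeplitz_mul_ge _ _ g0 U0) _.
    apply: le_trans (idterm_coercive (Y_ge0 i (j i)) (Tg0 _ _) (@gs _ _)) _.
    by rewrite ler_pM2l// lerD2r.
  rewrite trmxK; apply: idterm_le_lower => //.
  exact: (pos_of_support Yil (Tg0 i l) (@gs i l)).
(* Positivity on K gives both the continuity of F there and the support condition at the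
   minimizer. *)
have Kprop v : K v -> v^T \is a mxOver Num.nneg /\
    forall i l, 0 < Y i l -> 0 < (toeplitz v^T *m U) i l.
  move=> [vbox vpos]; split.
    apply/mxOverP => i k; rewrite mxE (ord1 k).
    by have := vbox i; rewrite /= in_itv/= => /andP[].
  move=> i l Yil; apply: lt_le_trans (vpos (i, l) Yil).
  by rewrite mulr_gt0// expR_gt0.
have Kcompact : compact K.
  apply: compact_closedI.
    apply: (@rV_compact R N.+1 (fun i => `[0, C i]%classic)) => i.
    exact: segment_compact.
  apply: closed_bigI => -[i l] /= Yil.
  apply: (@preimage_closed _ _ (fun v => (toeplitz v^T *m U) i l)
    [set x | e i l <= x]%classic); last exact: closed_ge.
  by move=> v _; exact: continuous_toeplitz_mul.
have Fcont : {within K, continuous (fun v : 'rV[R]_N.+1 => F v^T)}%classic.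
  apply: continuous_in_subspaceT => v; rewrite inE => /Kprop[v0 vpos].
  apply: continuous_at_sum => i; apply: continuous_at_sum => l.
  apply: (@continuous_comp _ _ _ (fun v => (toeplitz v^T *m U) i l)).
    exact: continuous_toeplitz_mul.
  exact: continuous_idterm (Y_ge0 i l) (vpos i l).
have K0 : (K !=set0)%classic by exists h0^T; exact: sublevelK.
have [v] := EVT_min_rV K0 Kcompact Fcont.
rewrite inE => /[dup] Kv /Kprop[v0 vpos] vmin.
exists v^T; split=> // [i l Til|g g0 gs].
  apply/eqP; rewrite eq_le (Y_ge0 i l : 0 <= _) andbT leNgt; apply/negP => /vpos.
  by rewrite Til ltxx.
(* A competitor with F g >= F h0 may lie outside K, but h0 is in K, so the minimum over K is at most
   F h0. *)
have [Fg|/ltW Fg] := leP (F g) (F h0).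
  by have := vmin g^T; rewrite inE trmxK; apply; exact: sublevelK.
apply: le_trans Fg; have := vmin h0^T; rewrite inE trmxK; apply.
exact: sublevelK.
Qed.

(** * Strict convexity and uniqueness *)

Lemma Idivr_toeplitz_midpoint_lt (R : realType) (N m : nat)
    (Y U : 'M[R]_(N.+1, m)) (h g : 'cV[R]_N.+1) :
  Y \is a mxOver Num.nneg -> U \is a mxOver Num.nneg ->
  (forall i : 'I_N.+1, exists j : 'I_m, 0 < Y i j /\ 0 < U ord0 j) ->
  h \is a mxOver Num.nneg -> g \is a mxOver Num.nneg ->
  support_le Y (toeplitz h *m U) -> support_le Y (toeplitz g *m U) ->
  h != g ->
  2 * Idivr Y (toeplitz (2^-1 *: (h + g)) *m U) <
    Idivr Y (toeplitz h *m U) + Idivr Y (toeplitz g *m U).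
Proof.
move=> Y0 U0 YU h0 g0 hs gs hg.
rewrite toeplitz_midpoint -scalemxAl mulmxDl.
have [i0 hgi0] : exists i, h i 0 != g i 0.
  apply/existsP; apply: contraNT hg => /existsPn eqhg.
  by apply/eqP/matrixP => i k; rewrite (ord1 k); apply/eqP/negPn/eqhg.
(* The least differing index, so that [toeplitz_mul_sub] applies. *)
have [i hgi imin] := @arg_minnP _ i0 (fun i => h i 0 != g i 0) (@nat_of_ord _) hgi0.
have [j [Yij Uj]] := YU i.
apply: (@Idivr_midpoint_lt _ _ _ _ _ _ i j) => //; try exact: toeplitz_mul_ge0.
rewrite -subr_eq0 toeplitz_mul_sub ?mulf_neq0 ?subr_eq0 ?(gt_eqF Uj)// => k ki.
by apply/eqP; apply: contraLR ki => /imin; rewrite -leqNgt.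
Qed.

(** [feasible] excludes an objective that is +oo everywhere, as when a column of U vanishes but that
    of Y does not; then every point of the orthant would be a minimizer. *)
Theorem mainTheorem2 (R : realType) (N m : nat) (m_ge1 : (1 <= m)%N)
    (Y U : 'M[R]_(N.+1, m))
    (Y_ge0 : Y \is a mxOver Num.nneg) (U_ge0 : U \is a mxOver Num.nneg)
    (YU_gt0 : forall i : 'I_N.+1, exists j : 'I_m, 0 < Y i j /\ 0 < U ord0 j)
    (feasible : exists h : 'cV[R]_N.+1,
       orthant h /\ (objective Y U h < +oo)%E) :
  exists! h : 'cV[R]_N.+1, is_minimizer (@orthant R N.+1) (objective Y U) h.
Proof.
have [h0 [h0_ge0 /Idiv_lty h0_supp]] := feasible.
have U_pos : forall i : 'I_N.+1, exists j, 0 < U ord0 j.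
  by move=> i; have [j []] := YU_gt0 i; exists j.
have [h [h_ge0 h_supp h_min]] :=
  Idivr_toeplitz_has_min Y_ge0 U_ge0 U_pos h0_ge0 h0_supp.
exists h; split.
  split=> // g g_ge0; have [|] := leP +oo%E (objective Y U g).
    by apply: le_trans; exact: leey.
  by move=> /Idiv_lty gs; rewrite /objective !Idiv_fin// lee_fin; exact: h_min.
move=> g [g_ge0 g_min].
have gs : support_le Y (toeplitz g *m U).
  apply: Idiv_lty; apply: le_lt_trans (g_min _ h_ge0) _.
  by rewrite /objective Idiv_fin// ltry.
apply/eqP/negPn/negP => hg.
have mid := Idivr_toeplitz_midpoint_lt Y_ge0 U_ge0 YU_gt0 h_ge0 g_ge0 h_supp gs hg.
have mid_ge0 : 2^-1 *: (h + g) \is a mxOver Num.nneg.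
  by apply: mxOverZ; [rewrite nnegrE invr_ge0|exact: rpredD].
have mid_supp : support_le Y (toeplitz (2^-1 *: (h + g)) *m U).
  move=> i j; rewrite toeplitz_midpoint -scalemxAl mulmxDl mxE mxE => /eqP.
  rewrite mulf_eq0 invr_eq0 pnatr_eq0/=.
  (* A sum of nonnegative entries vanishes only if both do. *)
  rewrite paddr_eq0 => [/andP[/eqP/h_supp]//||];
    exact: (mxOverP (toeplitz_mul_ge0 _ U_ge0)).
have hm := h_min _ mid_ge0 mid_supp.
have gm : Idivr Y (toeplitz g *m U) <= Idivr Y (toeplitz h *m U).
  by have := g_min _ h_ge0; rewrite /objective !Idiv_fin// lee_fin.
(* Contradiction: 2 F(mid) < F h + F g <= 2 F h <= 2 F(mid). *)
lra.
Qed.
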